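(* Let $(Q_n(\cdot,\cdot),n\ge1)$ be an infinitely exchangeable collection of ancestral branching Markov kernels on $(\mathcal{T}_n,n\ge1)$, and suppose that for each $n\ge1$, $\rho_n(\cdot)$ is a unique stationary distribution for $Q_n(\cdot,\cdot)$. Then the family $(\rho_n(\cdot),n\ge1)$ is infinitely exchangeable.
   Context: A fragmentation tree of a finite set $A\subset\mathbb{N}$ is a collection $T$ of non-empty subsets of $A$ with $A\in T$ (the root), containing all singletons, any two elements being disjoint or nested. $\mathcal{T}_n$ is the set of fragmentation trees of $[n]=\{1,\dots,n\}$. The parent of $t\neq A$ is the smallest element of $T$ strictly containing $t$; the root partition $\Pi_T$ is the set of elements whose parent is the root. $T_{|S}=\{t\cap S:t\in T\}\setminus\{\emptyset\}$; $\mathbf{1}_b=\{b\}$. An ancestral branching Markov kernel on $\mathcal{T}_n$ is a kernel of the form $$Q_n(T,T')=\prod_{b\in T':\#b\ge2}\frac{p_b(\Pi_{T_{|b}},\Pi_{T'_{|b}})}{1-p_b(\Pi_{T_{|b}},\mathbf{1}_b)},$$ where each $p_b(\cdot,\cdot)$ is a Markov kernel on the set of partitions of $b$ with $p_b(\cdot,\mathbf{1}_b)<1$. For $m\le n$ and an injection $\varphi:[m]\to[n]$, the associated projection $\varphi^*:\mathcal{T}_n\to\mathcal{T}_m$ is $\varphi^*(T)=\{\varphi^{-1}(t):t\in T\}\setminus\{\emptyset\}$. The family of kernels is infinitely exchangeable if $Q_m(t,\cdot)=Q_n(t^*,\varphi^{*-1}(\cdot))$ for all $m\le n$, all injections $\varphi:[m]\to[n]$,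 all $t\in\mathcal{T}_m$ and all $t^*\in\varphi^{*-1}(t)$. A family of measures $(\rho_n)$ on $(\mathcal{T}_n)$ is infinitely exchangeable if $\rho_m=\rho_n\varphi^{*-1}$ for all $m\le n$ and all injections $\varphi:[m]\to[n]$. *)

(* Defs.v *)
From mathcomp Require Import all_boot all_order all_algebra.
From mathcomp Require Import reals.

Set Implicit Arguments.
Unset Strict Implicit.
Unset Printing Implicit Defensive.

Import Order.TTheory GRing.Theory Num.Theory.
Local Open Scope ring_scope.

Section FragmentationTrees.
Variable U : finType.
Implicit Types (A b t u v : {set U}) (T : {set {set U}}).

Definition frag_tree A T : bool :=
  [&& [forall t in T, (t != set0) && (t \subset A)],
      A \in T,
      [forall x in A, [set x] \in T] &
      [forall t in T, forall u in T,
         [|| [disjoint t & u], t \subset u | u \subset t]]].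

Definition is_parent T u t : bool :=
  [&& u \in T, t \proper u &
      [forall v in T, (t \proper v) ==> (u \subset v)]].

Definition root_partition A T : {set {set U}} :=
  [set t in T | is_parent T A t].

Definition restr T b : {set {set U}} :=
  [set t :&: b | t in T] :\ set0.

End FragmentationTrees.

(* [n] is represented by 'I_n, i.e. the labels 1, ..., n are shifted to
   0, ..., n-1.  There is no fragmentation tree of the empty set, so [tree 0]
   is empty. *)
Definition tree (n : nat) := {T : {set {set 'I_n}} | frag_tree [set: 'I_n] T}.

Section Projection.
Variables (m n : nat) (phi : 'I_m -> 'I_n).

Definition proj_set (T : {set {set 'I_n}}) : {set {set 'I_m}} :=
  [set phi @^-1: t | t : {set 'I_n} in T] :\ set0.

Lemma proj_set_frag_tree (m_gt0 : (0 < m)%N) (phi_inj : injective phi)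
    (T : {set {set 'I_n}}) :
  frag_tree [set: 'I_n] T -> frag_tree [set: 'I_m] (proj_set T).
Proof.
case/and4P=> _ TT /forall_inP Ts /forall_inP Td; apply/and4P; split.
- by apply/forall_inP=> t /setD1P[-> _]; rewrite subsetT.
- apply/setD1P; split; first by apply/set0Pn; exists (Ordinal m_gt0).
  by apply/imsetP; exists [set: 'I_n]; rewrite ?preimsetT.
- apply/forall_inP=> x _; apply/setD1P; split.
    by apply/set0Pn; exists x; rewrite inE.
  apply/imsetP; exists [set phi x]; first exact: Ts.
  by apply/setP=> y; rewrite !inE (inj_eq phi_inj).
- apply/forall_inP=> _ /setD1P[_ /imsetP[t tT ->]].
  apply/forall_inP=> _ /setD1P[_ /imsetP[u uT ->]].
  have /forall_inP/(_ u uT)/or3P[] := Td t tT.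
  + by rewrite -!setI_eq0 -preimsetI => /eqP->; rewrite preimset0 eqxx.
  + by move=> tu; rewrite preimsetS ?orbT.
  + by move=> ut; rewrite (preimsetS _ ut) !orbT.
Qed.

Definition proj (m_gt0 : (0 < m)%N) (phi_inj : injective phi) (T : tree n) :
    tree m :=
  exist _ (proj_set (val T)) (proj_set_frag_tree m_gt0 phi_inj (valP T)).

End Projection.

Section Kernels.
Variable R : realType.

Definition mass (X : finType) (mu : X -> R) (S : {set X}) : R :=
  \sum_(x in S) mu x.

Definition markov_kernel_on (X : finType) (S : {set X}) (k : X -> X -> R) :
    Prop :=
  forall x, x \in S -> (forall y, y \in S -> 0 <= k x y) /\ mass (k x) S = 1.

Definition prob_dist (X : finType) (mu : X -> R) : Prop :=
  (forall x, 0 <= mu x) /\ mass mu [set: X] = 1.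

Definition stationary (X : finType) (k : X -> X -> R) (mu : X -> R) : Prop :=
  prob_dist mu /\ forall y, \sum_x mu x * k x y = mu y.

Definition unique_stationary (X : finType) (k : X -> X -> R) (mu : X -> R) :
    Prop :=
  stationary k mu /\ forall nu, stationary k nu -> nu =1 mu.

Definition partitions (U : finType) (b : {set U}) : {set {set {set U}}} :=
  [set P | partition P b].

(* The kernels [p b] only matter for #|b| >= 2; when #|b| = 1 the only
   partition of b is [set b] and p_b(., 1_b) < 1 could not hold. *)
Definition ancestral_branching (n : nat) (Q : tree n -> tree n -> R) : Prop :=
  markov_kernel_on [set: tree n] Q /\
  exists p : {set 'I_n} -> {set {set 'I_n}} -> {set {set 'I_n}} -> R,
    (forall b : {set 'I_n}, (2 <= #|b|)%N ->
       markov_kernel_on (partitions b) (p b) /\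
       forall P, P \in partitions b -> p b P [set b] < 1) /\
    forall T T' : tree n,
      Q T T' =
      \prod_(b in val T' | (2 <= #|b|)%N)
        (p b (root_partition b (restr (val T) b))
             (root_partition b (restr (val T') b))
         / (1 - p b (root_partition b (restr (val T) b)) [set b])).

Definition kernels_inf_exch (Q : forall n, tree n -> tree n -> R) : Prop :=
  forall (m n : nat) (m_gt0 : (0 < m)%N), (m <= n)%N ->
  forall (phi : 'I_m -> 'I_n) (phi_inj : injective phi)
         (t : tree m) (tstar : tree n), proj m_gt0 phi_inj tstar = t ->
  forall S : {set tree m},
    mass (Q m t) S = mass (Q n tstar) (proj m_gt0 phi_inj @^-1: S).

Definition measures_inf_exch (rho : forall n, tree n -> R) : Prop :=
  forall (m n : nat) (m_gt0 : (0 < m)%N), (m <= n)%N ->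
  forall (phi : 'I_m -> 'I_n) (phi_inj : injective phi) (S : {set tree m}),
    mass (rho m) S = mass (rho n) (proj m_gt0 phi_inj @^-1: S).

End Kernels.

(* Main.v *)
(* The push-forward of a stationary law of [Q n] along a projection is
   stationary for [Q m], because exchangeability of the kernels says that the
   projection intertwines [Q n] and [Q m]; uniqueness identifies it with
   [rho m]. *)
Require Import Defs.
From mathcomp Require Import all_boot all_order all_algebra.
From mathcomp Require Import reals.

Import Order.TTheory GRing.Theory Num.Theory.
Local Open Scope ring_scope.

Section PushForward.
Variables (R : realType) (X Y : finType) (f : X -> Y).

Definition push (mu : X -> R) (y : Y) : R := mass mu (f @^-1: [set y]).

Lemma pushE mu y : push mu y = \sum_(x | f x == y) mu x.
Proof. by apply: eq_bigl => x; rewrite !inE. Qed.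

(** Change of variables: grouping the right-hand sum by fibres of [f] works because [g (f x)] is
    constant on each fibre. *)
Lemma sum_push mu (g : Y -> R) (S : {set Y}) :
  \sum_(y in S) push mu y * g y = \sum_(x in f @^-1: S) mu x * g (f x).
Proof.
rewrite [RHS](partition_big f (mem S)) => [|x]; last by rewrite inE.
apply: eq_bigr => y yS; rewrite pushE mulr_suml.
apply: eq_big => [x|x /eqP -> //].
by rewrite inE; case: eqP => [->|]; rewrite ?andbF // yS.
Qed.

Lemma mass_push mu (S : {set Y}) : mass (push mu) S = mass mu (f @^-1: S).
Proof.
have := sum_push mu (fun=> 1) S.
by under eq_bigr do rewrite mulr1; under [RHS]eq_bigr do rewrite mulr1.
Qed.

(** The hypothesis is Dynkin's lumpability criterion: under [k], the law of the next [f]-value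
    depends on the current state only through its [f]-value. *)
Lemma stationary_push (k : X -> X -> R) (l : Y -> Y -> R) mu :
    (forall x y, l (f x) y = push (k x) y) ->
  stationary k mu -> stationary l (push mu).
Proof.
move=> kl [[mu_ge0 mu1] mu_stat]; split.
  by split=> [y|]; [exact: sumr_ge0 | rewrite mass_push preimsetT].
move=> y; have := sum_push mu (l^~ y) [set: Y].
rewrite preimsetT; under eq_bigl do rewrite inE; move=> ->.
under eq_bigl do rewrite inE.
under eq_bigr do rewrite kl /push /mass mulr_sumr.
(* After the swap, each [x] in the fibre over [y] contributes exactly the stationarity equation of
   [mu] at [x]. *)
by rewrite exchange_big; apply: eq_bigr => x _; exact: mu_stat.
Qed.

End PushForward.

Theorem proposition5p3 (R : realType)
    (Q : forall n : nat, tree n -> tree n -> R)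
    (rho : forall n : nat, tree n -> R)
    (Q_ab : forall n : nat, (1 <= n)%N -> ancestral_branching (Q n))
    (Q_exch : kernels_inf_exch Q)
    (rho_stat : forall n : nat, (1 <= n)%N ->
       unique_stationary (Q n) (rho n)) :
  measures_inf_exch rho.
Proof.
move=> m n m_gt0 le_mn phi phi_inj S.
have [rho_n_stat _] := rho_stat n (leq_trans m_gt0 le_mn).
have [_ rho_m_uniq] := rho_stat m m_gt0.
rewrite -mass_push; apply: eq_bigr => t _; apply/esym/rho_m_uniq.
apply: stationary_push rho_n_stat => s t'.
(* Lumpability is exchangeability of the kernels at the event [[set t']], with [s] as the chosen
   lift of its own projection. *)
by rewrite /push -(Q_exch _ _ _ le_mn _ _ _ _ erefl) /mass big_set1.
Qed.
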